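(* Let $T$ be a tree and $k$ a positive integer. Then $\gamma_{\rm SMB}'(T)=k$ if and only if $T$ contains a substructure $S$ from $\mathcal{S}_k$, and no substructure from $\bigcup_{i=1}^{k-1}\mathcal{S}_i$.
   Context: The Maker-Breaker domination game on a finite simple graph $G$: Dominator and Staller alternately claim previously unclaimed vertices of $G$. Staller wins if she claims all vertices of the closed neighborhood $N_G[v]$ of some vertex $v$; otherwise Dominator wins. In the S-game Staller moves first. $\gamma_{\rm SMB}'(G)$ is the minimum number of moves Staller needs to win the S-game under optimal play (Staller minimizing the number of her moves, Dominator trying to prevent or delay her win), and $\gamma_{\rm SMB}'(G)=\infty$ if Staller has no winning strategy. Families $\mathcal{S}_k$ of graphs, each $S\in\mathcal{S}_k$ with a vertex subset $X(S)$ (the vertices with fixed degrees), are defined recursively: $\mathcal{S}_1=\{P_1\}$ with $X(P_1)=V(P_1)$. For $k\ge2$, $\mathcal{S}_k^*$ consists of graphs obtained by taking vertex-disjoint $S^1\in\mathcal{S}_{k-1}$ and $S^2\in\bigcup_{i=1}^{k-1}\mathcal{S}_i$, a new vertex $z_k$, choosing $x^j\in X(S^j)$ for $j=1,2$, and joining $z_k$ to $x^1$ and $x^2$; then $X(S)=X(S^1)\cup X(S^2)$. Set $\mathcal{S}_k=\mathcal{S}_k^*\setminus\bigcup_{i=1}^{k-1}\mathcal{S}_i$. A graph $S\in\bigcup_k\mathcal{S}_k$ is a substructure in a graph $G$ if $S$ is (isomorphic to) a subgraph of $G$ and $\deg_G(x)=\deg_S(x)$ for every $x\in X(S)$. *)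

(* Defs.v *)
From Corelib Require Import Setoid.
From mathcomp Require Import all_boot.

Set Implicit Arguments.
Unset Strict Implicit.
Unset Printing Implicit Defensive.

Record sgraph := SGraph {
  vert :> finType;
  adj : rel vert;
  adj_sym : symmetric adj;
  adj_irr : irreflexive adj
}.

Definition deg (G : sgraph) (v : G) : nat := #|[set u | adj v u]|.

Definition closed_nbh (G : sgraph) (v : G) : {set G} :=
  [set u | (u == v) || adj v u].

Definition is_connected (G : sgraph) : Prop :=
  forall u v : G, connect (@adj G) u v.

(* [cycle] also holds of [:: u; v] for every edge uv, hence the size bound. *)
Definition is_acyclic (G : sgraph) : Prop :=
  forall c : seq G, 2 < size c -> ~ ucycle (@adj G) c.

Definition is_tree (G : sgraph) : Prop :=
  [/\ 0 < #|G|, is_connected G & is_acyclic G].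

Definition staller_won (G : sgraph) (A : {set G}) : bool :=
  [exists v : G, closed_nbh v \subset A].

(* [staller_forces n A B]: it is Staller's turn, she owns A, Dominator owns B,
   she has not won yet, and she can force a win with at most n further moves
   of her own.  If she has not won when all vertices are claimed, Dominator
   wins; this is why a free vertex must remain for Dominator's reply. *)
Fixpoint staller_forces (G : sgraph) (n : nat) (A B : {set G}) : bool :=
  if n is n'.+1 then
    [exists x : G, (x \notin A :|: B) &&
      (staller_won (x |: A) ||
       ([exists y, y \notin (x |: A) :|: B] &&
        [forall (y | y \notin (x |: A) :|: B),
           staller_forces n' (x |: A) (y |: B)]))]
  else false.

(* None stands for infinity.  Searching up to #|G| loses nothing, because
   Staller never makes more than #|G| moves; see [gammaSMB'_Some] and
   [gammaSMB'_None]. *)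
Definition gammaSMB' (G : sgraph) : option nat :=
  ohead [seq n <- iota 0 #|G|.+1 | @staller_forces G n set0 set0].

Lemma staller_forcesS (G : sgraph) n (A B : {set G}) :
  staller_forces n A B -> staller_forces n.+1 A B.
Proof.
elim: n A B => [//|n IHn] A B /existsP[x /andP[xF h]].
apply/existsP; exists x; rewrite xF /=.
case/orP: h => [->//|/andP[-> /forall_inP h]]; apply/orP; right => /=.
by apply/forall_inP => y yF; apply: IHn; apply: h.
Qed.

Lemma staller_forces_leq (G : sgraph) m n (A B : {set G}) :
  m <= n -> staller_forces m A B -> staller_forces n A B.
Proof.
by move/subnK <-; elim: (n - m) => // d IHd /IHd; apply: staller_forcesS.
Qed.

Lemma staller_forces_bound (G : sgraph) n (A B : {set G}) :
  staller_forces n A B -> staller_forces #|~: (A :|: B)| A B.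
Proof.
elim: n A B => [//|n IHn] A B /existsP[x /andP[xF h]].
rewrite (cardsD1 x) in_setC xF add1n.
apply/existsP; exists x; rewrite xF /=.
case/orP: h => [->//|/andP[-> /forall_inP h]]; apply/orP; right => /=.
apply/forall_inP => y yF; apply: (staller_forces_leq _ (IHn _ _ (h y yF))).
apply: subset_leq_card; apply/subsetP => z; rewrite !inE.
by case: (z == x); case: (z \in A); case: (z \in B); case: (z == y).
Qed.

Lemma gammaSMB'_Some (G : sgraph) k :
  gammaSMB' G = Some k <->
  @staller_forces G k set0 set0 /\
  (forall j, j < k -> ~~ @staller_forces G j set0 set0).
Proof.
rewrite /gammaSMB'; set P := fun n => @staller_forces G n set0 set0.
have firstP m b : ohead [seq n <- iota b m | P n] = Some k <->
    [/\ b <= k < b + m, P k & forall j, b <= j < k -> ~~ P j].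
  elim: m b => [|m IHm] b /=.
    by split=> // -[/andP[bk]]; rewrite addn0 ltnNge bk.
  case: (boolP (P b)) => Pb /=.
    split=> [[<-]|[/andP[bk _] _ h]].
      split=> //; first by rewrite leqnn addnS ltnS leq_addr.
      by move=> j /andP[bj /(leq_ltn_trans bj)]; rewrite ltnn.
    congr Some; apply/eqP; rewrite eqn_leq bk /= leqNgt.
    by apply/negP => bk'; move: (h b); rewrite leqnn bk' Pb => /(_ isT).
  rewrite IHm addSnnS; split=> -[/andP[bk kb] Pk h].
    split=> //; first by rewrite (ltnW bk).
    move=> j /andP[]; rewrite leq_eqVlt => /predU1P[<- //|bj jk].
    by apply: h; rewrite bj.
  split=> //; last by move=> j /andP[bj jk]; apply: h; rewrite (ltnW bj).
  rewrite kb andbT ltn_neqAle bk andbT.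
  by apply: contraNneq Pb => ->.
rewrite firstP; split=> [[_ Pk h]|[Pk h]].
  by split=> // j jk; apply: h.
split=> //; rewrite add0n ltnS leq0n leqNgt; apply/negP => lk.
have := staller_forces_bound Pk; rewrite setU0 setC0 cardsT => PG.
by have := h _ lk; rewrite /P PG.
Qed.

Lemma gammaSMB'_None (G : sgraph) :
  gammaSMB' G = None <-> forall k, ~~ @staller_forces G k set0 set0.
Proof.
split=> [gN k|h].
  apply/negP => /staller_forces_bound.
  rewrite setU0 setC0 cardsT => PG.
  have: #|G| \in [seq n <- iota 0 #|G|.+1 | @staller_forces G n set0 set0].
    by rewrite mem_filter PG mem_iota add0n ltnSn.
  by move: gN; rewrite /gammaSMB'; case: [seq _ <- _ | _].
by case gE: (gammaSMB' G) => [k|//]; case/gammaSMB'_Some: gE (h k) => ->.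
Qed.

(* A graph family whose members G come with a vertex subset X. *)
Definition marked_family := forall G : sgraph, {set G} -> Prop.

Definition marked_iso (G : sgraph) (X : {set G}) (H : sgraph) (Y : {set H}) :
  Prop :=
  exists f : G -> H,
    [/\ bijective f, forall u v, adj (f u) (f v) = adj u v & f @: X = Y].

(* The disjoint union of G1 and G2 with a new vertex [None] joined to x1 and
   x2. *)
Definition glue_adj (G1 G2 : sgraph) (x1 : G1) (x2 : G2)
    (u v : option (G1 + G2)) : bool :=
  match u, v with
  | Some (inl a), Some (inl b) => adj a b
  | Some (inr a), Some (inr b) => adj a b
  | None, Some (inl a) | Some (inl a), None => a == x1
  | None, Some (inr a) | Some (inr a), None => a == x2
  | _, _ => false
  end.

Lemma glue_sym (G1 G2 : sgraph) (x1 : G1) (x2 : G2) :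
  symmetric (glue_adj x1 x2).
Proof. by move=> [[a|a]|] [[b|b]|] //=; apply: adj_sym. Qed.

Lemma glue_irr (G1 G2 : sgraph) (x1 : G1) (x2 : G2) :
  irreflexive (glue_adj x1 x2).
Proof. by move=> [[a|a]|] //=; apply: adj_irr. Qed.

Definition glue (G1 G2 : sgraph) (x1 : G1) (x2 : G2) : sgraph :=
  SGraph (glue_sym x1 x2) (glue_irr x1 x2).

Definition glue_marks (G1 G2 : sgraph) (x1 : G1) (x2 : G2)
    (X1 : {set G1}) (X2 : {set G2}) : {set glue x1 x2} :=
  [set Some (inl x) | x in X1] :|: [set Some (inr x) | x in X2].

Definition P1_family : marked_family := fun G X => #|G| = 1 /\ X = [set: G].

Definition join_family (F1 F2 : marked_family) : marked_family :=
  fun G X =>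
    exists (G1 : sgraph) (X1 : {set G1}) (G2 : sgraph) (X2 : {set G2})
           (x1 : G1) (x2 : G2),
      [/\ F1 G1 X1, F2 G2 X2, x1 \in X1, x2 \in X2 &
          marked_iso X (glue_marks x1 x2 X1 X2)].

(* The pair (S_k, S_1 U ... U S_k), empty for k = 0.  Families are closed under
   isomorphism, and the set difference is one of graphs, regardless of their
   marks.  [Sfamily_rec] states the recursion with the unions written out. *)
Fixpoint Sfamilies (k : nat) : marked_family * marked_family :=
  if k is k'.+1 then
    let: (F, U) := Sfamilies k' in
    let F' : marked_family :=
      if k' is 0 then P1_family
      else fun G X => join_family F U X /\ ~ (exists X' : {set G}, U G X') in
    (F', fun G X => U G X \/ F' G X)
  else (fun _ _ => False, fun _ _ => False).

Definition Sfamily (k : nat) : marked_family := (Sfamilies k).1.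

Lemma Sfamilies_union k (G : sgraph) (X : {set G}) :
  (Sfamilies k).2 G X <-> exists2 i, 0 < i <= k & Sfamily i X.
Proof.
elim: k => [|k IHk]; first by split=> // -[[|i]].
have -> : (Sfamilies k.+1).2 G X = ((Sfamilies k).2 G X \/ Sfamily k.+1 X).
  by rewrite /Sfamily /=; case: (Sfamilies k).
rewrite IHk; split=> [[[i /andP[i0 ik] Fi]|Fk]|[i /andP[i0]]].
- by exists i => //; rewrite i0 leqW.
- by exists k.+1; rewrite ?leqnn.
- rewrite leq_eqVlt => /predU1P[->|ik Fi]; [by right|left].
  by exists i => //; rewrite i0.
Qed.

Lemma Sfamily_1 (G : sgraph) (X : {set G}) : Sfamily 1 X <-> P1_family X.
Proof. by []. Qed.

Lemma join_family_ext (F1 F2 F2' : marked_family) (G : sgraph) (X : {set G}) :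
  (forall (H : sgraph) (Y : {set H}), F2 H Y <-> F2' H Y) ->
  join_family F1 F2 X <-> join_family F1 F2' X.
Proof.
by move=> eF; split=> -[G1 [X1 [G2 [X2 [x1 [x2 [h1 h2 h3 h4 h5]]]]]]];
  exists G1, X1, G2, X2, x1, x2; split=> //; apply/eF.
Qed.

Lemma Sfamily_rec k (G : sgraph) (X : {set G}) : 1 < k ->
  Sfamily k X <->
  join_family (Sfamily k.-1)
    (fun H Y => exists2 i, 0 < i <= k.-1 & @Sfamily i H Y) X /\
  ~ (exists i, 0 < i <= k.-1 /\ exists X' : {set G}, Sfamily i X').
Proof.
case: k => [|[|k]] // _; rewrite [k.+2.-1]/=.
have -> : Sfamily k.+2 X =
    (join_family (Sfamily k.+1) (Sfamilies k.+1).2 X /\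
     ~ exists X' : {set G}, (Sfamilies k.+1).2 G X').
  by rewrite /Sfamily /=; case: (Sfamilies k).
rewrite (join_family_ext _ _ (@Sfamilies_union k.+1)).
split=> -[h1 h2]; split=> // h; apply: h2.
  by case: h => i [ik [X' FX']]; exists X'; apply/Sfamilies_union; exists i.
by case: h => X' /Sfamilies_union[i ik Fi]; exists i; split=> //; exists X'.
Qed.

Definition substructure (S : sgraph) (X : {set S}) (G : sgraph) : Prop :=
  exists f : S -> G,
    [/\ injective f,
        forall u v, adj u v -> adj (f u) (f v) &
        forall x, x \in X -> deg (f x) = deg x].

Definition contains_substructure_from (F : marked_family) (G : sgraph) : Prop :=
  exists (S : sgraph) (X : {set S}), F S X /\ substructure X G.

(* Main.v *)
Require Import Defs.
From mathcomp Require Import all_boot.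
From Stdlib Require Import Classical_Prop.

(** Let U_n be S_1 ∪ ... ∪ S_n.  A position (A, B) with Staller to move is
    winning in n moves if a member of U_n embeds in the free part of the graph
    in such a way that the neighbours of a marked vertex outside the embedding
    are all in A: Staller claims the joining vertex z and continues in a half
    that Dominator's reply missed.

    Conversely, in a forest, Dominator maintains that every vertex of A has a
    vertex of B in its closed neighbourhood, so that only free vertices can
    still be the centre of a winning neighbourhood, and that no member of U_n
    embeds as above.  When Staller claims x, every new embedding of a member
    of U_{n-1} has a neighbour of x among its marked vertices.  Embeddings that
    reach two different neighbours of x are disjoint, since the graph is
    acyclic, and joining them at x gives an embedding of a member of U_n.  So
    one neighbour of x lies in all of them, and Dominator claims it.

    That the sets S_k are defined by set difference of unmarked graphs is
    harmless because the marks are determined by the graph: they form the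
    larger colour class of a connected bipartite graph. *)

Set Implicit Arguments.
Unset Strict Implicit.
Unset Printing Implicit Defensive.

Lemma homo_connect (T T' : finType) (e : rel T) (e' : rel T') (f : T -> T') :
  {homo f : x y / e x y >-> e' x y} ->
  {homo f : x y / connect e x y >-> connect e' x y}.
Proof.
move=> hf x y /connectP[p ep ->]; apply/connectP; exists (map f p).
  by apply: homo_path ep.
by rewrite last_map.
Qed.

Lemma closed_nbh_id (G : sgraph) (v : G) : v \in closed_nbh v.
Proof. by rewrite inE eqxx. Qed.

Lemma card_closed_nbh (G : sgraph) (v : G) : #|closed_nbh v| = (deg v).+1.
Proof.
rewrite (cardsD1 v) closed_nbh_id add1n /deg; congr _.+1; apply: eq_card => u.
by rewrite !inE; case: eqVneq => // ->; rewrite adj_irr.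
Qed.

(** * The families of substructures *)

Definition Sunion (n : nat) : marked_family :=
  fun G X => exists2 i, 0 < i <= n & @Sfamily i G X.

Lemma Sunion_leq m n (G : sgraph) (X : {set G}) :
  m <= n -> Sunion m X -> Sunion n X.
Proof.
move=> mn [i /andP[i0 im] Fi]; exists i => //.
by rewrite i0 (leq_trans im).
Qed.

(** With [Sunion_P1] and [Sunion_join] as converses, this yields a recursion for the unions U_n that
    is symmetric in the two halves and has no set difference. *)
Lemma Sunion_inv n (G : sgraph) (X : {set G}) :
  Sunion n.+1 X -> P1_family X \/ join_family (Sunion n) (Sunion n) X.
Proof.
case=> -[|[|i]] // /andP[_ ik]; first by move/Sfamily_1; left.
case/(@Sfamily_rec i.+2 _ _ isT) => -[G1 [X1 [G2 [X2 [x1 [x2 []]]]]]].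
move=> F1 F2 x1X x2X iso _; right; exists G1, X1, G2, X2, x1, x2.
split=> //; last by apply: Sunion_leq F2.
by exists i.+1.
Qed.

Lemma marked_iso_refl (G : sgraph) (X : {set G}) : marked_iso X X.
Proof. by exists id; split=> //; [exists id | rewrite imset_id]. Qed.

Lemma marked_iso_trans (G H K : sgraph) (X : {set G}) (Y : {set H})
    (Z : {set K}) :
  marked_iso X Y -> marked_iso Y Z -> marked_iso X Z.
Proof.
case=> f [bf ef <-] [g [bg eg <-]]; exists (g \o f).
split; first exact: bij_comp.
  by move=> u v /=; rewrite eg ef.
by rewrite imset_comp.
Qed.

Lemma glue_swap_iso (G1 G2 : sgraph) (x1 : G1) (x2 : G2) X1 X2 :
  marked_iso (glue_marks x1 x2 X1 X2) (glue_marks x2 x1 X2 X1).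
Proof.
pose sw (A B : Type) (u : option (A + B)) : option (B + A) :=
  omap (fun w => match w with inl a => inr a | inr b => inl b end) u.
exists (sw _ _); split.
- by exists (sw _ _) => -[[a|a]|].
- by move=> [[a|a]|] [[b|b]|].
- by rewrite /glue_marks imsetU -!imset_comp setUC.
Qed.

Lemma join_family_sym (F1 F2 : marked_family) (G : sgraph) (X : {set G}) :
  join_family F1 F2 X -> join_family F2 F1 X.
Proof.
case=> G1 [X1 [G2 [X2 [x1 [x2 [F1X F2X x1X x2X iso]]]]]].
exists G2, X2, G1, X1, x2, x1; split=> //.
exact: marked_iso_trans iso (glue_swap_iso _ _ _ _).
Qed.

(** The last clause gives [X] exactly one vertex more than its complement, which singles it out
    among the two colour classes. *)
Definition major_colour (G : sgraph) (X : {set G}) :=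
  [/\ is_connected G,
      forall u v : G, adj u v -> (u \in X) != (v \in X) &
      #|X|.*2 = #|G|.+1].

(** Membership in [X] and in [Y] both flip along each edge, so by connectivity the two sets are
    equal or complementary; each has more than half of the vertices, which excludes the latter. *)
Lemma major_colour_uniq (G : sgraph) (X Y : {set G}) :
  major_colour X -> major_colour Y -> X = Y.
Proof.
move=> [conG aX cX] [_ aY cY].
pose d u := (u \in X) (+) (u \in Y).
have dE u v : d u = d v.
  have /connectP[p + ->] := conG u v; elim: p u => //= w p IHp u /andP[uw /IHp<-].
  by rewrite /d; move: (aX _ _ uw) (aY _ _ uw); do 4 case: (_ \in _).
case: (pickP d) => [u du|d0]; last first.
  apply/setP=> u; have := d0 u; rewrite /d.
  by case: (u \in X); case: (u \in Y).
suff XC : X = ~: Y.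
  have := cardsC Y; rewrite -XC => cXY.
  have eXY : #|Y| = #|X| by apply: double_inj; rewrite cX cY.
  by move: cX; rewrite -cXY eXY addnn => /n_Sn.
apply/setP=> w; have := dE w u; rewrite du /d inE.
by case: (w \in X); case: (w \in Y).
Qed.

Lemma major_colour_iso (G H : sgraph) (X : {set G}) (Y : {set H}) :
  marked_iso X Y -> major_colour Y -> major_colour X.
Proof.
case=> f [bf ef <-] [conH aY cY]; have injf := bij_inj bf.
have [g fK gK] := bf; split.
- move=> u v; rewrite -(fK u) -(fK v).
  have hg a b : adj a b -> adj (g a) (g b) by rewrite -ef !gK.
  exact: (homo_connect hg (conH _ _)).
- by move=> u v; rewrite -ef => /aY; rewrite !mem_imset.
- by rewrite (bij_eq_card bf) -cY card_imset.
Qed.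

(** The new vertex is adjacent to marked vertices only, so it joins the smaller class, and the sizes
    fit: (|G1| + 1) + (|G2| + 1) = (|G1| + |G2| + 1) + 1. *)
Lemma major_colour_glue (G1 G2 : sgraph) (x1 : G1) (x2 : G2)
    (X1 : {set G1}) (X2 : {set G2}) :
  x1 \in X1 -> x2 \in X2 -> major_colour X1 -> major_colour X2 ->
  major_colour (glue_marks x1 x2 X1 X2).
Proof.
move=> x1X x2X [con1 a1 c1] [con2 a2 c2].
pose i1 (a : G1) : glue x1 x2 := Some (inl a).
pose i2 (a : G2) : glue x1 x2 := Some (inr a).
have inj1 : injective i1 by move=> a b [].
have inj2 : injective i2 by move=> a b [].
have m1 a : (i1 a \in glue_marks x1 x2 X1 X2) = (a \in X1).
  rewrite inE mem_imset //; case: (a \in X1) => //=.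
  by apply/negbTE/imsetP => -[].
have m2 a : (i2 a \in glue_marks x1 x2 X1 X2) = (a \in X2).
  rewrite inE orbC mem_imset //; case: (a \in X2) => //=.
  by apply/negbTE/imsetP => -[].
have mN : (None \in glue_marks x1 x2 X1 X2) = false.
  by rewrite inE; apply/negbTE/norP; split; apply/imsetP => -[].
split.
- have csym : connect_sym (@adj (glue x1 x2)).
    exact/sym_connect_sym/adj_sym.
  have toN u : connect (@adj (glue x1 x2)) u None.
    case: u => [[a|a]|]; last exact: connect0.
      apply: connect_trans (connect1 (_ : adj (i1 x1) None)); last exact: eqxx.
      by apply: (homo_connect (f := i1)) (con1 a x1).
    apply: connect_trans (connect1 (_ : adj (i2 x2) None)); last exact: eqxx.
    by apply: (homo_connect (f := i2)) (con2 a x2).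
  by move=> u v; apply: connect_trans (toN u) _; rewrite csym.
- move=> [[a|a]|] [[b|b]|] //=; rewrite ?m1 ?m2 ?mN.
  + exact: a1.
  + by move/eqP->; rewrite x1X.
  + exact: a2.
  + by move/eqP->; rewrite x2X.
  + by move/eqP->; rewrite x1X.
  + by move/eqP->; rewrite x2X.
- have dis : [disjoint i1 @: X1 & i2 @: X2].
    by rewrite disjoints_subset; apply/subsetP => _ /imsetP[a _ ->];
      rewrite inE; apply/imsetP => -[].
  have [_ /esym cU] := leq_card_setU (i1 @: X1) (i2 @: X2).
  rewrite dis in cU; rewrite card_option card_sum.
  rewrite /glue_marks (eqP (esym cU)) !card_imset // doubleD c1 c2.
  by rewrite addSn addnS.
Qed.

Lemma major_colour_Sunion n (G : sgraph) (X : {set G}) :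
  Sunion n X -> major_colour X.
Proof.
elim: n G X => [|n IHn] G X; first by case=> -[].
case/Sunion_inv => [[G1 ->]|].
  have [s sE] := fintype1 G1; split=> [u v|u v|].
  - by rewrite (sE u) (sE v) connect0.
  - by rewrite (sE u) (sE v) adj_irr.
  - by rewrite cardsT G1.
case=> G1 [X1 [G2 [X2 [x1 [x2 [/IHn h1 /IHn h2 x1X x2X iso]]]]]].
by apply: major_colour_iso iso _; apply: major_colour_glue.
Qed.

Lemma Sunion_P1 n (G : sgraph) (X : {set G}) : P1_family X -> Sunion n.+1 X.
Proof. by move=> PX; exists 1 => //; apply/Sfamily_1. Qed.

(** The join has level [l.+1], where [l] is the larger level of the two halves, unless its graph
    occurs in U_l already. *)
Lemma Sunion_join n (G : sgraph) (X : {set G}) :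
  join_family (Sunion n) (Sunion n) X -> Sunion n.+1 X.
Proof.
case=> G1 [X1 [G2 [X2 [x1 [x2 []]]]]] [i /andP[i0 im] F1] [j /andP[j0 jm] F2].
move=> x1X x2X iso.
have [l ln [l0 jX]] : exists2 l, l <= n & 0 < l /\
    join_family (@Sfamily l) (Sunion l) X.
  case: (leqP j i) => [ji|/ltnW ij].
    exists i => //; split=> //; exists G1, X1, G2, X2, x1, x2; split=> //.
    by exists j; rewrite ?j0.
  exists j => //; split=> //; apply: join_family_sym.
  exists G1, X1, G2, X2, x1, x2; split=> //.
  by exists i; rewrite ?i0.
have XM : major_colour X.
  apply: major_colour_iso iso _; apply: major_colour_glue => //.
    by apply: (@major_colour_Sunion i); exists i; rewrite ?i0 /=.
  by apply: (@major_colour_Sunion j); exists j; rewrite ?j0 /=.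
(* If the graph lies in U_l with marks [X'], then [X'] is [X] by uniqueness, so the set difference
   only removes what U_l contains with the same marks. *)
case: (classic (exists X', @Sunion l G X')) => [[X' UX']|nX].
  rewrite (major_colour_uniq XM (major_colour_Sunion UX')).
  by apply: Sunion_leq UX'; apply: leqW.
exists l.+1; first by rewrite ltnS.
apply/Sfamily_rec; first by rewrite ltnS.
split=> // -[i' [i'l [X' FX']]].
by apply: nX; exists X'; exists i'.
Qed.

(** * Structures in a position of the game *)

Definition free_embedding (S : sgraph) (X : {set S}) (T : sgraph)
    (A B : {set T}) (f : S -> T) : Prop :=
  [/\ injective f,
      forall u v, adj u v -> adj (f u) (f v),
      forall u, f u \notin A :|: B &
      forall x, x \in X -> closed_nbh (f x) \subset f @: closed_nbh x :|: A].

Definition embeds_Sunion (T : sgraph) (n : nat) (A B : {set T}) : Prop :=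
  exists (S : sgraph) (X : {set S}),
    Sunion n X /\ exists f, free_embedding X A B f.

(** An embedding maps closed neighbourhoods into closed neighbourhoods, so with [A] empty the
    inclusion in [free_embedding] amounts to equal cardinalities, that is, equal degrees. *)
Lemma embeds_Sunion0 (T : sgraph) n :
  @embeds_Sunion T n set0 set0 <->
  contains_substructure_from (Sunion n) T.
Proof.
split=> -[S [X [UX [f]]]].
  case=> injf hf _ nf; exists S, X; split=> //; exists f; split=> // x xX.
  apply/succn_inj; rewrite -!card_closed_nbh -(card_imset _ injf).
  apply: eq_card; apply/subset_eqP/andP; split.
    by have := nf x xX; rewrite setU0.
  apply/subsetP => _ /imsetP[u + ->]; rewrite !inE => /predU1P[->|/hf->].
    by rewrite eqxx.
  by rewrite orbT.
case=> injf hf df; exists S, X; split=> //; exists f; split=> // [u|x xX].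
  by rewrite !inE.
rewrite setU0; suff /eqP-> : f @: closed_nbh x == closed_nbh (f x) by [].
rewrite eqEcard card_imset // !card_closed_nbh df // leqnn andbT.
apply/subsetP => _ /imsetP[u + ->]; rewrite !inE => /predU1P[->|/hf->].
  by rewrite eqxx.
by rewrite orbT.
Qed.

Lemma free_embedding_iso (S S' T : sgraph) (X : {set S}) (X' : {set S'})
    (A B : {set T}) f :
  marked_iso X X' -> free_embedding X A B f ->
  exists f', free_embedding X' A B f'.
Proof.
case=> g [[h gK hK] eg <-] [injf hf ff nf]; exists (f \o h).
have eh u v : adj (h u) (h v) = adj u v by rewrite -eg !hK.
split=> [|u v|u|_ /imsetP[x xX ->]] /=; last 1 first.
- rewrite gK; apply: subset_trans (nf x xX) _; apply: setSU.
  apply/subsetP => _ /imsetP[u ux ->]; rewrite -(gK u) -[f _]/((f \o h) (g u)).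
  apply: imset_f; move: ux; rewrite !inE eg.
  by case/predU1P => [->|->]; rewrite ?eqxx ?orbT.
- exact: inj_comp injf (can_inj hK).
- by rewrite -eh => /hf.
- exact: ff.
Qed.

(** One round of the game: Staller claims [f z] and Dominator replies [y]. The part given by [i],
    which [y] misses, survives because the only neighbour it may lose is [z], whose image is now
    Staller's. *)
Lemma free_embedding_sub (S S1 T : sgraph) (X : {set S}) (X1 : {set S1})
    (A B : {set T}) f (i : S1 -> S) (z : S) (y : T) :
  free_embedding X A B f -> injective i ->
  (forall u v, adj u v -> adj (i u) (i v)) ->
  (forall u, i u != z) -> (forall u, f (i u) != y) ->
  (forall x, x \in X1 -> i x \in X) ->
  (forall x, closed_nbh (i x) \subset z |: i @: closed_nbh x) ->
  free_embedding X1 (f z |: A) (y |: B) (f \o i).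
Proof.
case=> injf hf ff nf inji hi iz iy iX ni; split=> [|u v|u|x xX] /=.
- exact: inj_comp.
- by move/hi/hf.
- rewrite !inE (inj_eq injf) (negbTE (iz u)) (negbTE (iy u)) /=.
  by have := ff (i u); rewrite inE.
- apply: subset_trans (nf _ (iX _ xX)) _; apply/subsetP => w.
  rewrite !inE => /orP[|->]; last by rewrite !orbT.
  case/imsetP => u /(subsetP (ni x)); rewrite !inE => + ->.
  case/predU1P => [->|/imsetP[v vx ->]]; first by rewrite eqxx orbT.
  by rewrite -[f _]/((f \o i) v) imset_f.
Qed.

Lemma free_embedding_forces n (S T : sgraph) (X : {set S}) (A B : {set T}) f :
  Sunion n X -> free_embedding X A B f -> staller_forces n A B.
Proof.
elim: n S X A B f => [|n IHn] S X A B f; first by case=> -[].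
case/Sunion_inv => [[S1 ->] [injf hf ff nf]|].
  have [s sE] := fintype1 S1; apply/existsP; exists (f s); rewrite ff /=.
  apply/orP; left; apply/existsP; exists (f s).
  apply: subset_trans (nf s (in_setT _)) _; apply: setSU.
  by apply/subsetP => _ /imsetP[u _ ->]; rewrite (sE u) inE.
case=> G1 [X1 [G2 [X2 [x1 [x2 [U1 U2 x1X x2X iso]]]]]].
case/(free_embedding_iso iso) => {iso} {}f ef.
have [injf hf ff nf] := ef.
pose i1 (a : G1) : glue x1 x2 := Some (inl a).
pose i2 (a : G2) : glue x1 x2 := Some (inr a).
have inj1 : injective i1 by move=> a b [].
have inj2 : injective i2 by move=> a b [].
have nb1 x : closed_nbh (i1 x) \subset None |: i1 @: closed_nbh x.
  apply/subsetP => -[[a|a]|] //; rewrite !inE //= => h.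
  by rewrite -[Some _]/(i1 a) mem_imset // inE.
have nb2 x : closed_nbh (i2 x) \subset None |: i2 @: closed_nbh x.
  apply/subsetP => -[[a|a]|] //; rewrite !inE //= => h.
  by rewrite -[Some _]/(i2 a) mem_imset // inE.
apply/existsP; exists (f None); rewrite ff /=; apply/orP; right; apply/andP; split.
  (* The image of [x1] is still free, so Dominator has a reply, as [staller_forces] demands. *)
  apply/existsP; exists (f (i1 x1)); rewrite !inE (inj_eq injf) /=.
  by have := ff (i1 x1); rewrite inE.
apply/forall_inP => y _.
(* By injectivity [y] cannot hit both halves: if it hits the first, Staller goes on in the second,
   otherwise in the first. *)
case: (pickP (fun a => f (i1 a) == y)) => [a /eqP ay|ny].
  apply: (IHn _ X2 _ _ (f \o i2)) => //.
  apply: (free_embedding_sub ef) => // [u|x xX].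
    by rewrite -ay (inj_eq injf).
  by rewrite inE imset_f ?orbT.
apply: (IHn _ X1 _ _ (f \o i1)) => //.
apply: (free_embedding_sub ef) => // [u|x xX].
  by rewrite ny.
by rewrite inE imset_f.
Qed.

(** * Dominator's strategy on forests *)

(** Adjacency in T - [x], kept on the vertices of T, where [x] becomes isolated. *)
Definition avoid (T : sgraph) (x : T) : rel T :=
  [rel u v | [&& adj u v, u != x & v != x]].

(** A simple path from [u] to [v] that avoids [x] closes up through [x] to a cycle, of length at
    least 3 unless the path is empty. *)
Lemma acyclic_branch (T : sgraph) (x u v : T) :
  is_acyclic T -> adj x u -> adj x v -> connect (avoid x) u v -> u = v.
Proof.
move=> acT xu xv /connectP[p0 /shortenP[p pp up _] vE].
case: p pp up vE => [//|w p] pp up vE; case: (acT [:: x, u, w & p]) => //.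
have px z q : path (avoid x) z q -> x \notin q.
  elim: q z => //= a q IHq z /andP[/and3P[_ _ ax] /IHq xq].
  by rewrite inE negb_or eq_sym ax.
rewrite /ucycle /ucycleb /cycle rcons_path; apply/andP; split; last first.
  rewrite cons_uniq up andbT inE negb_or (px _ _ pp) andbT.
  by case: eqVneq xu => // ->; rewrite adj_irr.
apply/andP; split; last by rewrite /= -[last w p]/(last u (w :: p)) -vE adj_sym.
rewrite /= xu /=; apply: sub_path pp => a b.
by case/and3P.
Qed.

Lemma free_embedding_connect (S T : sgraph) (X : {set S}) (A B : {set T})
    x f (u v : S) :
  is_connected S -> free_embedding X (x |: A) B f ->
  connect (avoid x) (f u) (f v).
Proof.
move=> conS [_ hf ff _]; apply: homo_connect (conS u v) => a b ab.
have fx c : f c != x by have := ff c; rewrite !inE !negb_or => /andP[/andP[]].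
by rewrite /avoid /= hf ?fx.
Qed.

(** Owning [x] helps only where [x] is adjacent to the image of a marked vertex. *)
Lemma free_embedding_unclaim (S T : sgraph) (X : {set S}) (A B : {set T}) x f :
  free_embedding X (x |: A) B f -> (forall a, a \in X -> ~~ adj x (f a)) ->
  free_embedding X A B f.
Proof.
case=> injf hf ff nf nx; split=> // [u|a aX].
  by have := ff u; rewrite !inE !negb_or => /andP[/andP[_ ->] ->].
apply/subsetP => w wa; have := subsetP (nf a aX) w wa.
rewrite !inE => /or3P[->//| /eqP wx|->]; last by rewrite orbT.
move: wa; rewrite wx inE => /predU1P[xa|]; last first.
  by rewrite adj_sym (negbTE (nx a aX)).
by have := ff a; rewrite -xa !inE eqxx.
Qed.

Lemma free_embedding_unreply (S T : sgraph) (X : {set S}) (A B : {set T}) y f :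
  free_embedding X A (y |: B) f ->
  free_embedding X A B f /\ forall u, f u != y.
Proof.
case=> injf hf ff nf; split; first split=> // u.
  by have := ff u; rewrite !inE !negb_or => /and3P[-> _ ->].
by move=> u; have := ff u; rewrite !inE !negb_or => /and3P[].
Qed.

Definition glue_map (G1 G2 : sgraph) (x1 : G1) (x2 : G2) (T : Type)
    (f1 : G1 -> T) (f2 : G2 -> T) (z : T) (u : glue x1 x2) : T :=
  match u with
  | Some (inl a) => f1 a
  | Some (inr a) => f2 a
  | None => z
  end.

(** The two images contain distinct neighbours of [x], so they lie in different branches at [x]:
    they are disjoint, and each contains just one neighbour of [x]. *)
Lemma free_embedding_glue (G1 G2 T : sgraph) (X1 : {set G1}) (X2 : {set G2})
    (x1 : G1) (x2 : G2) (A B : {set T}) x f1 f2 :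
  is_acyclic T -> is_connected G1 -> is_connected G2 ->
  x \notin A :|: B ->
  free_embedding X1 (x |: A) B f1 -> free_embedding X2 (x |: A) B f2 ->
  adj x (f1 x1) -> adj x (f2 x2) -> f1 x1 != f2 x2 ->
  free_embedding (glue_marks x1 x2 X1 X2) A B (@glue_map _ _ x1 x2 _ f1 f2 x).
Proof.
move=> acT con1 con2 xF e1 e2 a1 a2 f12.
have dis a b : f1 a != f2 b.
  apply: contra f12 => /eqP ab; apply/eqP; apply: acyclic_branch acT a1 a2 _.
  apply: connect_trans (free_embedding_connect x1 a con1 e1) _.
  by rewrite ab; apply: free_embedding_connect con2 e2.
have n1 a : adj x (f1 a) -> a = x1.
  case: e1 (free_embedding_connect a x1 con1 e1) => injf _ _ _ c xa.
  exact/injf/(acyclic_branch acT xa a1).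
have n2 a : adj x (f2 a) -> a = x2.
  case: e2 (free_embedding_connect a x2 con2 e2) => injf _ _ _ c xa.
  exact/injf/(acyclic_branch acT xa a2).
have [inj1 h1 ff1 nf1] := e1; have [inj2 h2 ff2 nf2] := e2.
have fx1 a : (f1 a == x) = false.
  by apply/negbTE; have := ff1 a; rewrite !inE !negb_or => /andP[/andP[]].
have fx2 a : (f2 a == x) = false.
  by apply/negbTE; have := ff2 a; rewrite !inE !negb_or => /andP[/andP[]].
split.
- move=> [[a|a]|] [[b|b]|] //= /eqP.
  + by move/eqP/inj1->.
  + by rewrite (negbTE (dis _ _)).
  + by rewrite fx1.
  + by rewrite eq_sym (negbTE (dis _ _)).
  + by move/eqP/inj2->.
  + by rewrite fx2.
  + by rewrite eq_sym fx1.
  + by rewrite eq_sym fx2.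
- move=> [[a|a]|] [[b|b]|] //=.
  + exact: h1.
  + by move/eqP->; rewrite adj_sym.
  + exact: h2.
  + by move/eqP->; rewrite adj_sym.
  + by move/eqP->.
  + by move/eqP->.
- move=> [[a|a]|] //=.
    by have := ff1 a; rewrite !inE !negb_or => /andP[/andP[_ ->]].
  by have := ff2 a; rewrite !inE !negb_or => /andP[/andP[_ ->]].
- move=> u; rewrite inE => /orP[] /imsetP[a aX ->] /=.
    apply/subsetP => w wa; have := subsetP (nf1 a aX) w wa.
    rewrite !inE => /or3P[/imsetP[b ba ->]|/eqP wx|->]; last by rewrite orbT.
      apply/orP; left; apply/imsetP; exists (Some (inl b)) => //.
      by move: ba; rewrite !inE.
    (* Only [x1] can have its image adjacent to [x], and [x1] has the neighbour [None], mapped to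
       [x]; so [x] need not belong to Staller. *)
    apply/orP; left; apply/imsetP; exists None => //.
    move: wa; rewrite wx !inE eq_sym fx1 /= adj_sym => /n1->.
    exact: eqxx.
  apply/subsetP => w wa; have := subsetP (nf2 a aX) w wa.
  rewrite !inE => /or3P[/imsetP[b ba ->]|/eqP wx|->]; last by rewrite orbT.
    apply/orP; left; apply/imsetP; exists (Some (inr b)) => //.
    by move: ba; rewrite !inE.
  apply/orP; left; apply/imsetP; exists None => //.
  move: wa; rewrite wx !inE eq_sym fx2 /= adj_sym => /n2->.
  exact: eqxx.
Qed.

Definition one_vertex : sgraph :=
  @SGraph unit (fun _ _ => false) (fun _ _ => erefl) (fun _ => erefl).

Lemma embeds_one_vertex (T : sgraph) n (A B : {set T}) x :
  x \notin A :|: B -> closed_nbh x \subset x |: A -> embeds_Sunion n.+1 A B.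
Proof.
move=> xF xA; exists one_vertex, setT; split.
  by apply: Sunion_P1; rewrite /P1_family card_unit.
exists (fun=> x); split=> // [[] [] //|[] _].
apply: subset_trans xA _; apply: setSU; rewrite sub1set.
by apply/imsetP; exists tt => //; apply: closed_nbh_id.
Qed.

Lemma dominator_reply (T : sgraph) n (A B : {set T}) x y0 :
  is_acyclic T -> ~ embeds_Sunion n.+1 A B -> x \notin A :|: B ->
  y0 \notin (x |: A) :|: B ->
  exists y, [/\ y \notin (x |: A) :|: B,
    exists2 b, b \in closed_nbh x & b \in y |: B &
    ~ embeds_Sunion n (x |: A) (y |: B)].
Proof.
move=> acT noE xF y0F.
have noU S X f : @Sunion n S X -> free_embedding X (x |: A) B f ->
    exists2 a, a \in X & adj x (f a).
  move=> UX ef; apply/exists_inP; apply: contraT => /exists_inPn nx.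
  case: noE; exists S, X; split; first exact: Sunion_leq UX.
  by exists f; apply: free_embedding_unclaim ef nx.
(* Dominator replies at a marked neighbour [f1 a1] of [x] in some structure; a structure that misses
   this vertex has another neighbour [f2 a2] of [x], and the two glue at [x]. *)
case: (classic (embeds_Sunion n (x |: A) B)) => [[S1 [X1 [U1 [f1 e1]]]]|noE1].
  have [a1 a1X xa1] := noU _ _ _ U1 e1; exists (f1 a1); split.
  - by case: e1.
  - by exists (f1 a1); rewrite !inE ?xa1 ?eqxx ?orbT.
  case=> S2 [X2 [U2 [f2 /free_embedding_unreply[e2 ny]]]].
  have [a2 a2X xa2] := noU _ _ _ U2 e2; apply: noE.
  exists (glue a1 a2), (glue_marks a1 a2 X1 X2); split.
    apply: Sunion_join; exists S1, X1, S2, X2, a1, a2; split=> //.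
    exact: marked_iso_refl.
  have [con1 _ _] := major_colour_Sunion U1.
  have [con2 _ _] := major_colour_Sunion U2.
  by eexists; apply: free_embedding_glue e1 e2 xa1 xa2 _; rewrite // eq_sym.
have noE2 y : ~ embeds_Sunion n (x |: A) (y |: B).
  case=> S [X [UX [f /free_embedding_unreply[ef _]]]].
  by apply: noE1; exists S, X; split=> //; exists f.
(* With no structure to destroy, only the domination of [x] remains to be secured. If Staller owned
   the whole neighbourhood, [x] alone would have been a structure. *)
have /subsetPn[w wx wA] : ~~ (closed_nbh x \subset x |: A).
  by apply/negP => xA; apply: noE; apply: embeds_one_vertex xA.
(* If [w] is Dominator's already, any free reply will do, such as [y0]. *)
case: (boolP (w \in B)) => wB.
  by exists y0; split=> //; exists w; rewrite // inE wB orbT.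
exists w; split=> //; first by rewrite inE negb_or wA.
by exists w; rewrite // !inE eqxx.
Qed.

Lemma dominator_survives (T : sgraph) n (A B : {set T}) :
  is_acyclic T -> [disjoint A & B] ->
  (forall a, a \in A -> exists2 b, b \in closed_nbh a & b \in B) ->
  ~ embeds_Sunion n A B -> ~~ staller_forces n A B.
Proof.
move=> acT; elim: n A B => [//|n IHn] A B disAB domA noE.
apply/negP => /existsP[x /andP[xF /orP[/existsP[v vW]|]]].
  (* The centre [v] of a won neighbourhood is either [x], which then was a structure by itself, or a
     vertex of [A], whose neighbourhood meets [B]. *)
  have := subsetP vW v (closed_nbh_id v); rewrite !inE => /predU1P[vx|vA].
    by apply: noE; apply: embeds_one_vertex xF _; rewrite -vx in vW *.
  have [b bv bB] := domA v vA; have := subsetP vW b bv.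
  rewrite !inE (disjointFl disAB bB) orbF => /eqP bx.
  by move: xF; rewrite -bx inE bB orbT.
case/andP => /existsP[y0 y0F] /forall_inP h.
have [y [yF domx noy]] := dominator_reply acT noE xF y0F.
move: (h y yF); apply/negP; apply: IHn noy.
- rewrite disjoints_subset; apply/subsetP => w; rewrite !inE negb_or.
  move: yF xF; rewrite !inE !negb_or => /andP[/andP[yx yA] yB] /andP[xA xB].
  case/predU1P => [->|wA]; first by rewrite eq_sym yx.
  rewrite (disjointFr disAB wA) andbT.
  by apply: contraNneq yA => <-.
- move=> a; rewrite inE => /orP[/set1P->//|/domA[b ba bB]].
  by exists b; rewrite // inE bB orbT.
Qed.

(** * From winning positions to the value of the game *)

Lemma staller_forces_acyclic (T : sgraph) n :
  is_acyclic T ->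
  @staller_forces T n set0 set0 <-> contains_substructure_from (Sunion n) T.
Proof.
move=> acT; split=> [Tn|/embeds_Sunion0[S [X [UX [f]]]]]; last first.
  exact: free_embedding_forces.
apply/embeds_Sunion0; apply: NNPP => noE.
apply: (negP (dominator_survives acT _ _ noE)) Tn => [|a].
  by rewrite disjoints_subset sub0set.
by rewrite inE.
Qed.

Theorem theorem13 (T : sgraph) (k : nat) (hT : is_tree T) (hk : 0 < k) :
  gammaSMB' T = Some k <->
  contains_substructure_from (@Sfamily k) T /\
  (forall i : nat, 0 < i < k ->
     ~ contains_substructure_from (@Sfamily i) T).
Proof.
have [_ _ acT] := hT; have forcesE n := staller_forces_acyclic n acT.
rewrite gammaSMB'_Some; split=> [[/forcesE[S [X [[i /andP[i0 ik] Fi] XT]]] nj]|].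
  have noj j : 0 < j < k -> ~ contains_substructure_from (@Sfamily j) T.
    case/andP => j0 jk [S' [X' [Fj X'T]]]; move/negP: (nj j jk); apply.
    apply/forcesE; exists S', X'; split=> //.
    by exists j; rewrite // j0 leqnn.
  (* The structure found has some level [i <= k], and [i < k] is excluded by [noj]. *)
  split=> //; move: ik; rewrite leq_eqVlt => /predU1P[<-|ik].
    by exists S, X.
  by case: (noj i); rewrite ?i0 //; exists S, X.
case=> -[S [X [FX XT]]] noi; split.
  by apply/forcesE; exists S, X; split=> //; exists k; rewrite // hk leqnn.
move=> j jk; apply/negP => /forcesE[S' [X' [[i /andP[i0 ij] Fi] X'T]]].
case: (noi i); last by exists S', X'.
by rewrite i0 (leq_ltn_trans ij).
Qed.
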